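(* Let $\Bbbk$ be an algebraically closed field, and let $\mathcal{C}$ be a braided semi-rigid monoidal category over $\Bbbk$ of moderate growth such that $\operatorname{Irr}(\mathcal{C})$ has a recursive filtration with respect to a subset $S\subset\operatorname{Irr}(\mathcal{C})$ consisting of non-negligible objects. Then $\mathcal{C}$ is rigid, i.e., every object of $\mathcal{C}$ is rigid.
   Context: $\mathbf{1}$ denotes the monoidal unit. An r-category is a monoidal category $\mathcal{C}$ such that for every $X\in\mathcal{C}$ the functor $Z\mapsto\operatorname{Hom}(Z\otimes X,\mathbf{1})$ is representable by some object $X^{\vee}$, and the resulting functor $\vee:\mathcal{C}\to\mathcal{C}^{\rm mop}$ (the category with both tensor product and arrows reversed) is an equivalence. A semi-rigid monoidal category over $\Bbbk$ is a ($\Bbbk$-linear) abelian r-category over $\Bbbk$ with objects of finite length and simple $\mathbf{1}$; in such a category Hom spaces are finite dimensional and $\operatorname{End}(\mathbf{1})=\Bbbk$. $\operatorname{Irr}(\mathcal{C})$ is the set of isomorphism classes of simple objects. A recursive filtration on $\operatorname{Irr}(\mathcal{C})$ relative to a subset $S\subset\operatorname{Irr}(\mathcal{C})$ is an increasing exhaustive filtration of $\operatorname{Irr}(\mathcal{C})$ by subsets $\operatorname{Irr}_n(\mathcal{C})$, $n\in\mathbb{Z}_{\ge0}$, such that for every $n\ge0$ and $X\in\operatorname{Irr}_n(\mathcal{C})$ there exist $m\ge 0$ and objects $X_1,\dots,X_m\in\mathcal{C}$ with all composition factors in $S$ for which the composition series of $X_1\otimes\cdots\otimes X_m$ consists of a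 single copy of $X$ and elements of $\operatorname{Irr}_{n-1}(\mathcal{C})$, where $\operatorname{Irr}_{-1}(\mathcal{C}):=\emptyset$ (for $m=0$ the empty tensor product is $\mathbf{1}$). An indecomposable object $X$ is non-negligible if there exists $Y\in\mathcal{C}$ such that $\mathbf{1}$ is a direct summand of $Y\otimes X$. An object $X$ has moderate growth if there exists $n\in\mathbb{N}$ with $\dim_{\Bbbk}\operatorname{End}(X^{\otimes n})<n!$; $\mathcal{C}$ has moderate growth if all its indecomposable objects do. An object is rigid if it admits a left dual and a right dual. *)

(* Defs.v *)
From HB Require Import structures.
From Stdlib Require List.
From mathcomp Require Import all_boot all_order all_algebra.

Set Implicit Arguments.
Unset Strict Implicit.
Unset Printing Implicit Defensive.

Import GRing.Theory.
Local Open Scope ring_scope.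

Reserved Notation "g \co f" (at level 40, left associativity).
Reserved Notation "X \ot Y" (at level 38, left associativity).
Reserved Notation "f \otm g" (at level 38, left associativity).

(* Hom spaces are finite-dimensional because they carry a [vectType]
   structure. *)
Record lincat (k : fieldType) := LinCat {
  obj :> Type;
  Hom : obj -> obj -> vectType k;
  idm : forall X, Hom X X;
  compm : forall X Y Z, Hom Y Z -> Hom X Y -> Hom X Z;
  comp1m : forall X Y (f : Hom X Y), compm (idm Y) f = f;
  compm1 : forall X Y (f : Hom X Y), compm f (idm X) = f;
  compA : forall X Y Z W (h : Hom Z W) (g : Hom Y Z) (f : Hom X Y),
    compm h (compm g f) = compm (compm h g) f;
  comp_linear_r : forall X Y Z (g : Hom Y Z),
    linear (fun f : Hom X Y => compm g f);
  comp_linear_l : forall X Y Z (f : Hom X Y),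
    linear (fun g : Hom Y Z => compm g f)
}.

Arguments idm {k l} X.
Arguments compm {k l X Y Z} g f.
Notation "g \co f" := (compm g f).

Definition opcat (k : fieldType) (C : lincat k) : lincat k :=
  @LinCat k C (fun X Y => Hom Y X) (fun X => idm X)
    (fun X Y Z g f => f \co g)
    (fun X Y f => compm1 f) (fun X Y f => comp1m f)
    (fun X Y Z W h g f => esym (compA f g h))
    (fun X Y Z g => @comp_linear_l k C Z Y X g)
    (fun X Y Z f => @comp_linear_r k C Z Y X f).

Record functor (k : fieldType) (C D : lincat k) := Functor {
  fobj :> C -> D;
  fmor : forall X Y : C, Hom X Y -> Hom (fobj X) (fobj Y);
  fmor1 : forall X : C, fmor (idm X) = idm (fobj X);
  fmor_comp : forall (X Y Z : C) (g : Hom Y Z) (f : Hom X Y),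
    fmor (g \co f) = fmor g \co fmor f
}.

Section Abelian.
Variables (k : fieldType) (C : lincat k).
Implicit Types X Y Z A B : C.

Definition is_iso X Y (f : Hom X Y) : Prop :=
  exists g : Hom Y X, g \co f = idm X /\ f \co g = idm Y.

Definition isomorphic X Y : Prop := exists f : Hom X Y, is_iso f.

Definition mono X Y (f : Hom X Y) : Prop :=
  forall Z (u v : Hom Z X), f \co u = f \co v -> u = v.

Definition epi X Y (f : Hom X Y) : Prop :=
  forall Z (u v : Hom Y Z), u \co f = v \co f -> u = v.

Definition is_zero Z : Prop :=
  (forall X (f : Hom Z X), f = 0) /\ (forall X (f : Hom X Z), f = 0).

Definition is_biproduct A B X : Prop :=
  exists (i1 : Hom A X) (i2 : Hom B X) (p1 : Hom X A) (p2 : Hom X B),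
    [/\ p1 \co i1 = idm A, p2 \co i2 = idm B,
        p1 \co i2 = 0, p2 \co i1 = 0
      & i1 \co p1 + i2 \co p2 = idm X].

Definition is_kernel K X Y (f : Hom X Y) (i : Hom K X) : Prop :=
  f \co i = 0 /\
  forall Z (g : Hom Z X), f \co g = 0 -> exists! h : Hom Z K, i \co h = g.

Definition is_cokernel X Y Q (f : Hom X Y) (p : Hom Y Q) : Prop :=
  p \co f = 0 /\
  forall Z (g : Hom Y Z), g \co f = 0 -> exists! h : Hom Q Z, h \co p = g.

Record abelian : Prop := Abelian {
  ab_zero : exists Z, is_zero Z;
  ab_biproduct : forall A B, exists X, is_biproduct A B X;
  ab_kernel : forall X Y (f : Hom X Y), exists K (i : Hom K X), is_kernel f i;
  ab_cokernel : forall X Y (f : Hom X Y),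
    exists Q (p : Hom Y Q), is_cokernel f p;
  ab_mono : forall X Y (f : Hom X Y), mono f ->
    exists Z (g : Hom Y Z), is_kernel g f;
  ab_epi : forall X Y (f : Hom X Y), epi f ->
    exists Z (g : Hom Z X), is_cokernel g f
}.

Definition short_exact A X B (i : Hom A X) (p : Hom X B) : Prop :=
  is_kernel p i /\ is_cokernel i p.

Definition simple X : Prop :=
  ~ is_zero X /\
  forall A (i : Hom A X), mono i -> is_zero A \/ is_iso i.

(* [comp_series X s]: X has a composition series 0 = X_0 < ... < X_n = X whose
   successive quotients are, from the top down, the entries of s. *)
Inductive comp_series : C -> seq C -> Prop :=
  | comp_series_nil X : is_zero X -> comp_series X [::]
  | comp_series_cons A X T s (i : Hom A X) (p : Hom X T) :
      short_exact i p -> simple T -> comp_series A s ->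
      comp_series X (T :: s).

Definition comp_factor T X : Prop :=
  exists2 s, comp_series X s & List.In T s.

Definition finite_length X : Prop := exists s, comp_series X s.

Definition indecomposable X : Prop :=
  ~ is_zero X /\
  forall A B, is_biproduct A B X -> is_zero A \/ is_zero B.

Definition direct_summand A X : Prop := exists B, is_biproduct A B X.

(* A subset of Irr(C), given as an isomorphism-invariant predicate on simple
   objects. *)
Definition irr_subset (P : C -> Prop) : Prop :=
  (forall X, P X -> simple X) /\
  (forall X Y, P X -> isomorphic X Y -> P Y).

End Abelian.

Definition equivalence (k : fieldType) (C D : lincat k) (F : functor C D) :
    Prop :=
  exists (G : functor D C)
         (eta : forall X : C, Hom X (G (F X)))
         (eps : forall Y : D, Hom (F (G Y)) Y),
    [/\ forall X, is_iso (eta X),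
        forall Y, is_iso (eps Y),
        forall (X X' : C) (f : Hom X X'),
          eta X' \co f = fmor G (fmor F f) \co eta X
      & forall (Y Y' : D) (g : Hom Y Y'),
          g \co eps Y = eps Y' \co fmor F (fmor G g)].

Record moncat (k : fieldType) := MonCat {
  mcat :> lincat k;
  munit : mcat;
  tens : mcat -> mcat -> mcat;
  tensm : forall X Y X' Y' : mcat,
    Hom X X' -> Hom Y Y' -> Hom (tens X Y) (tens X' Y');
  tensm1 : forall X Y : mcat, tensm (idm X) (idm Y) = idm (tens X Y);
  tensm_comp : forall (X X' X'' Y Y' Y'' : mcat)
      (f' : Hom X' X'') (f : Hom X X') (g' : Hom Y' Y'') (g : Hom Y Y'),
    tensm (f' \co f) (g' \co g) = tensm f' g' \co tensm f g;
  tensm_linear_r : forall (X X' Y Y' : mcat) (f : Hom X X'),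
    linear (fun g : Hom Y Y' => tensm f g);
  tensm_linear_l : forall (X X' Y Y' : mcat) (g : Hom Y Y'),
    linear (fun f : Hom X X' => tensm f g);
  ass : forall X Y Z : mcat, Hom (tens (tens X Y) Z) (tens X (tens Y Z));
  assV : forall X Y Z : mcat, Hom (tens X (tens Y Z)) (tens (tens X Y) Z);
  assK : forall X Y Z, assV X Y Z \co ass X Y Z = idm _;
  assVK : forall X Y Z, ass X Y Z \co assV X Y Z = idm _;
  ass_natural : forall (X X' Y Y' Z Z' : mcat)
      (f : Hom X X') (g : Hom Y Y') (h : Hom Z Z'),
    ass X' Y' Z' \co tensm (tensm f g) h =
    tensm f (tensm g h) \co ass X Y Z;
  lun : forall X : mcat, Hom (tens munit X) X;
  lunV : forall X : mcat, Hom X (tens munit X);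
  lunK : forall X, lunV X \co lun X = idm _;
  lunVK : forall X, lun X \co lunV X = idm _;
  lun_natural : forall (X Y : mcat) (f : Hom X Y),
    lun Y \co tensm (idm munit) f = f \co lun X;
  run : forall X : mcat, Hom (tens X munit) X;
  runV : forall X : mcat, Hom X (tens X munit);
  runK : forall X, runV X \co run X = idm _;
  runVK : forall X, run X \co runV X = idm _;
  run_natural : forall (X Y : mcat) (f : Hom X Y),
    run Y \co tensm f (idm munit) = f \co run X;
  pentagon : forall X Y Z W : mcat,
    tensm (idm X) (ass Y Z W) \co ass X (tens Y Z) W
      \co tensm (ass X Y Z) (idm W) =
    ass X Y (tens Z W) \co ass (tens X Y) Z W;
  triangle : forall X Y : mcat,
    tensm (idm X) (lun Y) \co ass X munit Y = tensm (run X) (idm Y)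
}.

Arguments munit {k m}.
Arguments tens {k m} X Y.
Arguments tensm {k m X Y X' Y'} f g.
Arguments ass {k m} X Y Z.
Arguments assV {k m} X Y Z.
Arguments lun {k m} X.
Arguments lunV {k m} X.
Arguments run {k m} X.
Arguments runV {k m} X.
Notation "X \ot Y" := (tens X Y).
Notation "f \otm g" := (tensm f g).

Record braiding (k : fieldType) (C : moncat k) := Braiding {
  br : forall X Y : C, Hom (X \ot Y) (Y \ot X);
  br_iso : forall X Y, is_iso (br X Y);
  br_natural : forall (X X' Y Y' : C) (f : Hom X X') (g : Hom Y Y'),
    br X' Y' \co (f \otm g) = (g \otm f) \co br X Y;
  hexagon : forall X Y Z : C,
    ass Y Z X \co br X (Y \ot Z) \co ass X Y Z =
    (idm Y \otm br X Z) \co ass Y X Z \co (br X Y \otm idm Z);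
  hexagonV : forall X Y Z : C,
    assV Z X Y \co br (X \ot Y) Z \co assV X Y Z =
    (br X Z \otm idm Y) \co assV X Z Y \co (idm X \otm br Y Z)
}.

Section Monoidal.
Variables (k : fieldType) (C : moncat k).
Implicit Types X Y Z : C.

(* The functor Z |-> Hom(Z (x) X, 1) is represented by D, via phi. *)
Definition represents X (D : C)
    (phi : forall Z, Hom Z D -> Hom (Z \ot X) munit) : Prop :=
  (forall Z, bijective (@phi Z)) /\
  forall W Z (u : Hom W Z) (g : Hom Z D),
    phi W (g \co u) = phi Z g \co (u \otm idm X).

(* D X represents Z |-> Hom(Z (x) X, 1); the second clause is what determines
   the action of D on morphisms. *)
Definition is_duality (D : functor C (opcat C)) : Prop :=
  exists phi : forall X Z, Hom Z (D X : C) -> Hom (Z \ot X) munit,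
    (forall X, represents (phi X)) /\
    forall X Y Z (f : Hom X Y) (g : Hom Z (D Y : C)),
      phi X Z ((fmor D f : Hom (D Y : C) (D X : C)) \co g) =
      phi Y Z g \co (idm Z \otm f).

(* An equivalence of categories only, not of monoidal categories; the reversal
   of the tensor product in C^mop therefore plays no role. *)
Definition r_category : Prop :=
  exists2 D : functor C (opcat C), is_duality D & equivalence D.

Record semirigid : Prop := SemiRigid {
  sr_abelian : abelian C;
  sr_r_category : r_category;
  sr_finite_length : forall X, finite_length X;
  sr_simple_unit : simple (munit : C)
}.

Definition tens_seq (Xs : seq C) : C := foldr tens munit Xs.

Definition tens_pow X (n : nat) : C := tens_seq (nseq n X).

Definition moderate_growth X : Prop :=
  exists n : nat, (\dim {: Hom (tens_pow X n) (tens_pow X n)} < n`!)%N.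

Definition moderate_growth_cat : Prop :=
  forall X, indecomposable X -> moderate_growth X.

Definition non_negligible X : Prop :=
  indecomposable X /\ exists Y, direct_summand munit (Y \ot X).

Definition recursive_filtration (S : C -> Prop) (Irr : nat -> C -> Prop) :
    Prop :=
  let Irr_pred n := if n is m.+1 then Irr m else fun=> False in
  [/\ forall n, irr_subset (Irr n),
      forall n X, Irr n X -> Irr n.+1 X,
      forall X, simple X -> exists n, Irr n X
    & forall n X, Irr n X ->
        exists Xs : seq C,
          (forall Y, List.In Y Xs -> forall T, comp_factor T Y -> S T) /\
          exists s1 s2 : seq C,
            comp_series (tens_seq Xs) (s1 ++ X :: s2) /\
            forall T, List.In T (s1 ++ s2) -> Irr_pred n T].

Definition is_left_dual X Xd : Prop :=
  exists (ev : Hom (Xd \ot X) munit) (coev : Hom munit (X \ot Xd)),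
    run X \co (idm X \otm ev) \co ass X Xd X \co (coev \otm idm X)
      \co lunV X = idm X /\
    lun Xd \co (ev \otm idm Xd) \co assV Xd X Xd \co (idm Xd \otm coev)
      \co runV Xd = idm Xd.

(* Y is a right dual of X iff X is a left dual of Y. *)
Definition is_right_dual X Xd : Prop := is_left_dual Xd X.

Definition rigid X : Prop :=
  (exists Y, is_left_dual X Y) /\ (exists Y, is_right_dual X Y).

End Monoidal.

(* Main.v *)
From HB Require Import structures.
From mathcomp Require Import all_boot all_order all_algebra.
Require Import Defs.

(** Call [X] dualizable when [1 -> X (x) D X] exists whose zigzag with the
    evaluation [D X (x) X -> 1] of the r-category duality is the identity.

    For [X] in [S], let [p : Y (x) X -> 1] and [i : 1 -> Y (x) X] satisfy
    [p i = 1]. Braiding [i] into [1 -> X (x) Y], with either sign of the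
    crossing, gives two zigzag endomorphisms of the simple object [X]. If one is
    nonzero it is invertible and [X] is dualizable. If both vanish, the partial
    trace [Hom(X (x) W, X (x) V) -> Hom(W, V)] defined by [p] and [i] kills a
    crossing of the first two strands, whatever its sign. Hence, with [c_j] the
    coset representatives of [S_n] in [S_(n+1)] lifted to braids, the trace of
    [c_j c_m^-1] is [delta_jm], so [(g_j) |-> sum_j (X (x) g_j) c_j] is an
    injection of [End(X^n)^(n+1)] into [End(X^(n+1))]; thus
    [dim End(X^n) >= n!], against moderate growth.

    In a short exact sequence, two dualizable objects make the third one
    dualizable: the tensor product is right exact because [- (x) X] has the
    right adjoint [D(X (x) D^-1 -)], and tensoring with a short exact sequence
    whose last term has a dual is exact. The recursive filtration then gives
    dualizability of the simple objects, and finite length that of all. *)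

Set Implicit Arguments.
Unset Strict Implicit.
Unset Printing Implicit Defensive.

Import GRing.Theory.
Local Open Scope ring_scope.

(** * Bilinearity of composition *)

Section Linear.
Variables (k : fieldType) (C : lincat k).
Implicit Types X Y Z : C.

Lemma linear_sub (U V : vectType k) (f : U -> V) : linear f ->
  forall x y, f (x - y) = f x - f y.
Proof. by move=> lf x y; rewrite addrC -scaleN1r lf scaleN1r addrC. Qed.

Lemma linear_zero (U V : vectType k) (f : U -> V) : linear f -> f 0 = 0.
Proof. by move=> lf; rewrite -(subrr 0) linear_sub // subrr. Qed.

Lemma linear_add (U V : vectType k) (f : U -> V) : linear f ->
  forall x y, f (x + y) = f x + f y.
Proof. by move=> lf x y; rewrite -[x]scale1r lf !scale1r. Qed.

Lemma linear_scale (U V : vectType k) (f : U -> V) : linear f ->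
  forall a x, f (a *: x) = a *: f x.
Proof. by move=> lf a x; rewrite -[a *: x]addr0 lf linear_zero // addr0. Qed.

Lemma comp0m X Y Z (f : Hom X Y) : (0 : Hom Y Z) \co f = 0.
Proof. exact: linear_zero (comp_linear_l f). Qed.
Lemma compm0 X Y Z (g : Hom Y Z) : g \co (0 : Hom X Y) = 0.
Proof. exact: linear_zero (comp_linear_r g). Qed.
Lemma compDl X Y Z (g g' : Hom Y Z) (f : Hom X Y) :
  (g + g') \co f = g \co f + g' \co f.
Proof. exact: linear_add (comp_linear_l f) _ _. Qed.
Lemma compDr X Y Z (g : Hom Y Z) (f f' : Hom X Y) :
  g \co (f + f') = g \co f + g \co f'.
Proof. exact: linear_add (comp_linear_r g) _ _. Qed.
Lemma compBl X Y Z (g g' : Hom Y Z) (f : Hom X Y) :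
  (g - g') \co f = g \co f - g' \co f.
Proof. exact: linear_sub (comp_linear_l f) _ _. Qed.
Lemma compBr X Y Z (g : Hom Y Z) (f f' : Hom X Y) :
  g \co (f - f') = g \co f - g \co f'.
Proof. exact: linear_sub (comp_linear_r g) _ _. Qed.
Lemma compZl X Y Z a (g : Hom Y Z) (f : Hom X Y) :
  (a *: g) \co f = a *: (g \co f).
Proof. exact: linear_scale (comp_linear_l f) _ _. Qed.
Lemma compZr X Y Z a (g : Hom Y Z) (f : Hom X Y) :
  g \co (a *: f) = a *: (g \co f).
Proof. exact: linear_scale (comp_linear_r g) _ _. Qed.

Lemma split_mono X Y (r : Hom Y X) (f : Hom X Y) Z (u v : Hom Z X) :
  r \co f = idm X -> f \co u = f \co v -> u = v.
Proof. by move=> rf e; rewrite -[u]comp1m -[v]comp1m -rf -!compA e. Qed.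

Lemma split_epi X Y (r : Hom Y X) (f : Hom X Y) Z (u v : Hom Y Z) :
  f \co r = idm Y -> u \co f = v \co f -> u = v.
Proof. by move=> rf e; rewrite -[u]compm1 -[v]compm1 -rf !compA e. Qed.

End Linear.

Notation whl X f := (idm X \otm f).

(** * Tensor products of morphisms *)

Section Tensor.
Variables (k : fieldType) (C : moncat k).
Implicit Types X Y Z W : C.

Lemma whl_comp X Y Z W (g : Hom Z W) (f : Hom Y Z) :
  whl X (g \co f) = whl X g \co whl X f.
Proof. by rewrite -tensm_comp comp1m. Qed.
Lemma whlD X Y Z (f g : Hom Y Z) : whl X (f + g) = whl X f + whl X g.
Proof. exact: linear_add (tensm_linear_r (idm X)) _ _. Qed.
Lemma whlZ X Y Z a (f : Hom Y Z) : whl X (a *: f) = a *: whl X f.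
Proof. exact: linear_scale (tensm_linear_r (idm X)) _ _. Qed.
Lemma tens0m X Y Z W (g : Hom Z W) : (0 : Hom X Y) \otm g = 0.
Proof. exact: linear_zero (tensm_linear_l g). Qed.
Lemma tensm0 X Y Z W (f : Hom X Y) : f \otm (0 : Hom Z W) = 0.
Proof. exact: linear_zero (tensm_linear_r f). Qed.
Lemma tensBl X Y Z W (f f' : Hom X Y) (g : Hom Z W) :
  (f - f') \otm g = f \otm g - f' \otm g.
Proof. exact: linear_sub (tensm_linear_l g) _ _. Qed.

Lemma run_inj X Y (f g : Hom X Y) :
  f \otm idm munit = g \otm idm munit -> f = g.
Proof.
move=> h; rewrite -[f]compm1 -[g]compm1 -(runVK X) !compA.
by rewrite -!run_natural h.
Qed.

Lemma lun_inj X Y (f g : Hom X Y) : whl munit f = whl munit g -> f = g.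
Proof.
move=> h; rewrite -[f]compm1 -[g]compm1 -(lunVK X) !compA.
by rewrite -!lun_natural h.
Qed.

Lemma assV_natural X X' Y Y' Z Z' (f : Hom X X') (g : Hom Y Y')
    (h : Hom Z Z') :
  assV X' Y' Z' \co (f \otm (g \otm h)) = ((f \otm g) \otm h) \co assV X Y Z.
Proof.
apply: (split_mono (assK X' Y' Z')); rewrite !compA assVK comp1m ass_natural.
by rewrite -compA assVK compm1.
Qed.

(* Kelly: the triangle with the unit in front. *)
Lemma lun_ass X Y : lun (X \ot Y) \co ass munit X Y = lun X \otm idm Y.
Proof.
apply: lun_inj.
apply: (split_epi (assVK munit (munit \ot X) Y)).
apply: (split_epi (r := assV munit munit X \otm idm Y)
                  (f := ass munit munit X \otm idm Y)).
  by rewrite -tensm_comp assVK comp1m tensm1.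
have pent := congr1 (compm (whl munit (lun (X \ot Y))))
  (pentagon munit munit X Y).
rewrite !compA in pent; rewrite whl_comp pent triangle.
rewrite -[in RHS]ass_natural -[RHS]compA -tensm_comp triangle comp1m.
by rewrite -tensm1 ass_natural.
Qed.

End Tensor.

(** * Coherence *)

(* A morphism [f] between bracketed products is replaced by the family [gen f W]
   obtained by tensoring with a tail [W] and rebracketing everything to the
   right with [can]. Then [f (x) V] is the instance of the family at the tail
   [V (x) W] and all associators and unitors become identities: [mtail_inj]
   reduces an equation to its strictification. *)
Section Coherence.
Variables (k : fieldType) (C : moncat k).
Implicit Types X Y Z W V : C.

Inductive tree : Type := Leaf of C | Unit | Node of tree & tree.
Implicit Types r s t : tree.

Fixpoint otree t : C :=
  match t with
  | Leaf X => X
  | Unit => munit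
  | Node s t => otree s \ot otree t
  end.

Fixpoint nf t W : C :=
  match t with
  | Leaf X => X \ot W
  | Unit => W
  | Node s t => nf s (nf t W)
  end.

Fixpoint whisk t W W' (f : Hom W W') : Hom (nf t W) (nf t W') :=
  match t with
  | Leaf X => whl X f
  | Unit => f
  | Node s t => whisk s (whisk t f)
  end.
Arguments whisk t {W W'} f.

Fixpoint can t W : Hom (otree t \ot W) (nf t W) :=
  match t with
  | Leaf X => idm (X \ot W)
  | Unit => lun W
  | Node s t => can s (nf t W) \co whl (otree s) (can t W) \co ass _ _ _
  end.

Fixpoint canV t W : Hom (nf t W) (otree t \ot W) :=
  match t with
  | Leaf X => idm (X \ot W)
  | Unit => lunV W
  | Node s t => assV _ _ _ \co whl (otree s) (canV t W) \co canV s (nf t W)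
  end.

Lemma canK t W : canV t W \co can t W = idm _.
Proof.
elim: t W => [X|//|s IHs t IHt] W /=; [exact: comp1m | exact: lunK |].
rewrite -!compA (compA (canV s _)) IHs comp1m (compA (whl _ _)) -whl_comp.
by rewrite IHt tensm1 comp1m assK.
Qed.

Lemma canVK t W : can t W \co canV t W = idm _.
Proof.
elim: t W => [X|//|s IHs t IHt] W /=; [exact: comp1m | exact: lunVK |].
rewrite -!compA (compA (ass _ _ _)) assVK comp1m (compA (whl _ _)) -whl_comp.
by rewrite IHt tensm1 comp1m IHs.
Qed.

Lemma can_natural t W W' (f : Hom W W') :
  can t W' \co whl (otree t) f = whisk t f \co can t W.
Proof.
elim: t W W' f => [X|//|s IHs t IHt] W W' f /=.
- by rewrite comp1m compm1.
- exact: lun_natural.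
rewrite -compA -tensm1 ass_natural compA -(compA (can s _)) -whl_comp IHt.
by rewrite whl_comp !compA IHs.
Qed.

Fact gen_key : unit. Proof. exact: tt. Qed.
(* Locked so that rewriting with associativity does not unfold it. *)
Definition gen s t (f : Hom (otree s) (otree t)) W : Hom (nf s W) (nf t W) :=
  locked_with gen_key (can t W \co (f \otm idm W) \co canV s W).

Lemma genE s t (f : Hom (otree s) (otree t)) W :
  gen f W = can t W \co (f \otm idm W) \co canV s W.
Proof. exact: locked_withE. Qed.

Lemma gen_can s t (f : Hom (otree s) (otree t)) W :
  gen f W \co can s W = can t W \co (f \otm idm W).
Proof. by rewrite genE -!compA canK compm1. Qed.

Lemma canV_natural t W W' (f : Hom W W') :
  canV t W' \co whisk t f = whl (otree t) f \co canV t W.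
Proof.
apply: (split_mono (canK t W')); rewrite !compA canVK comp1m can_natural.
by rewrite -compA canVK compm1.
Qed.

Lemma gen_natural s t (f : Hom (otree s) (otree t)) W W' (g : Hom W W') :
  gen f W' \co whisk s g = whisk t g \co gen f W.
Proof.
rewrite !genE -compA canV_natural !compA -can_natural.
by rewrite -!(compA (can t W')) -!tensm_comp !comp1m !compm1.
Qed.

(** Expressions are indexed by trees because the strict form depends on bracketing and units, which
    an object of [C] does not record. *)
Inductive mexp : tree -> tree -> Type :=
  | MGen s t (f : Hom (otree s) (otree t)) : mexp s t
  | MId t : mexp t t
  | MComp r s t of mexp s t & mexp r s : mexp r t
  | MTens s s' t t' of mexp s s' & mexp t t' : mexp (Node s t) (Node s' t')
  | MAss r s t : mexp (Node (Node r s) t) (Node r (Node s t))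
  | MAssV r s t : mexp (Node r (Node s t)) (Node (Node r s) t)
  | MLun t : mexp (Node Unit t) t
  | MLunV t : mexp t (Node Unit t)
  | MRun t : mexp (Node t Unit) t
  | MRunV t : mexp t (Node t Unit).

Fixpoint meval s t (m : mexp s t) : Hom (otree s) (otree t) :=
  match m with
  | MGen s t f => f
  | MId t => idm (otree t)
  | MComp _ _ _ m n => meval m \co meval n
  | MTens _ _ _ _ m n => meval m \otm meval n
  | MAss r s t => ass (otree r) (otree s) (otree t)
  | MAssV r s t => assV (otree r) (otree s) (otree t)
  | MLun t => lun (otree t)
  | MLunV t => lunV (otree t)
  | MRun t => run (otree t)
  | MRunV t => runV (otree t)
  end.

Fixpoint mtail s t (m : mexp s t) W : Hom (nf s W) (nf t W) :=
  match m with
  | MGen s t f => gen f W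
  | MId t => idm (nf t W)
  | MComp _ _ _ m n => mtail m W \co mtail n W
  | MTens s s' t t' m n => mtail m (nf t' W) \co whisk s (mtail n W)
  | MAss r s t => idm (nf r (nf s (nf t W)))
  | MAssV r s t => idm (nf r (nf s (nf t W)))
  | MLun t => idm (nf t W)
  | MLunV t => idm (nf t W)
  | MRun t => idm (nf t W)
  | MRunV t => idm (nf t W)
  end.

Lemma can_inv s t W (f : Hom (otree s) (otree t))
    (g : Hom (otree t) (otree s)) :
  f \co g = idm _ -> forall h : Hom (nf s W) (nf t W),
  h \co can s W = can t W \co (f \otm idm W) ->
  forall h' : Hom (nf t W) (nf s W), h' \co h = idm _ ->
  h' \co can t W = can s W \co (g \otm idm W).
Proof.
move=> fg h hE h' h'h.
rewrite -[LHS]compm1 -tensm1 -fg -[idm W]comp1m tensm_comp compA.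
by rewrite -(compA h') -hE (compA h') h'h !comp1m.
Qed.

Lemma can_ass r s t W : can (Node (Node r s) t) W =
  can (Node r (Node s t)) W \co (ass (otree r) (otree s) (otree t) \otm idm W).
Proof.
rewrite /= !whl_comp -!compA; congr (_ \co _).
rewrite [in RHS](compA (whl _ (ass _ _ _))) pentagon !compA.
congr (_ \co _); rewrite -(compA _ _ (_ \otm can t W)) -tensm1 ass_natural.
by rewrite compA.
Qed.

Lemma can_lun t W :
  can (Node Unit t) W = can t W \co (lun (otree t) \otm idm W).
Proof. by rewrite /= lun_natural -compA lun_ass. Qed.

Lemma can_run t W :
  can (Node t Unit) W = can t W \co (run (otree t) \otm idm W).
Proof. by rewrite /= -compA triangle. Qed.

(** Induction on the expression: the pentagon and the triangles settle the structural morphisms,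
    naturality of [can] the tensor products. *)
Lemma mtail_eval s t (m : mexp s t) W :
  mtail m W \co can s W = can t W \co (meval m \otm idm W).
Proof.
elim: s t / m W => [s t f|t|r s t m IHm n IHn|s s' t t' m IHm n IHn|r s t|r s t
  |t|t|t|t] W; rewrite [mtail _ _]/= [meval _]/=.
- exact: gen_can.
- by rewrite tensm1 comp1m compm1.
- by rewrite -compA IHn compA IHm -compA -tensm_comp comp1m.
- rewrite /=.
  rewrite -(compA (mtail m _)) (compA (whisk _ _)) (compA (whisk _ _)).
  rewrite -can_natural.
  rewrite -(compA (can s _)) -whl_comp IHn whl_comp !compA IHm.
  rewrite -[RHS]compA ass_natural !compA; congr (_ \co _).
  rewrite -!(compA (can s' _)); congr (_ \co _).
  by rewrite -!tensm_comp !comp1m !compm1.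
- by rewrite comp1m can_ass.
- apply: (@can_inv (Node (Node r s) t) (Node r (Node s t)) W _ _
    (assVK _ _ _) (idm _) _ (idm _)); by rewrite comp1m ?can_ass.
- by rewrite comp1m can_lun.
- apply: (@can_inv (Node Unit t) t W _ _ (lunVK _) (idm _) _ (idm _));
    by rewrite comp1m ?can_lun.
- by rewrite comp1m can_run.
- apply: (@can_inv (Node t Unit) t W _ _ (runVK _) (idm _) _ (idm _));
    by rewrite comp1m ?can_run.
Qed.

(** The tail [munit] suffices because tensoring with the unit is faithful. *)
Theorem mtail_inj s t (m n : mexp s t) :
  mtail m munit = mtail n munit -> meval m = meval n.
Proof.
move=> e; apply: run_inj; apply: (split_mono (canK t munit)).
by rewrite -!mtail_eval e.
Qed.

(** Arbitrary tails let a known equation act on the leading strands of a longer product. *)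
Theorem mtail_eq s t (m n : mexp s t) W :
  meval m = meval n -> mtail m W = mtail n W.
Proof.
move=> e; apply: (split_epi (canVK s W)).
by rewrite !mtail_eval e.
Qed.

End Coherence.
Arguments Unit {k C}.
Arguments can {k C} t W.
Arguments canV {k C} t W.
Arguments whisk {k C} t {W W'} f.

Ltac reify_tree X :=
  lazymatch X with
  | @munit ?k ?C => constr:(@Unit k C)
  | @tens ?k ?C ?A ?B =>
      let s := reify_tree A in let t := reify_tree B in
      constr:(@Node k C s t)
  | _ => constr:(Leaf X)
  end.

Ltac reify_mor f :=
  lazymatch f with
  | @compm _ _ _ _ _ ?g ?h =>
      let m := reify_mor g in let n := reify_mor h in constr:(MComp m n)
  | @tensm _ _ _ _ _ _ ?g ?h =>
      let m := reify_mor g in let n := reify_mor h in constr:(MTens m n)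
  | @idm _ _ ?X => let t := reify_tree X in constr:(MId t)
  | @ass _ _ ?X ?Y ?Z =>
      let r := reify_tree X in let s := reify_tree Y in
      let t := reify_tree Z in constr:(MAss r s t)
  | @assV _ _ ?X ?Y ?Z =>
      let r := reify_tree X in let s := reify_tree Y in
      let t := reify_tree Z in constr:(MAssV r s t)
  | @lun _ _ ?X => let t := reify_tree X in constr:(MLun t)
  | @lunV _ _ ?X => let t := reify_tree X in constr:(MLunV t)
  | @run _ _ ?X => let t := reify_tree X in constr:(MRun t)
  | @runV _ _ ?X => let t := reify_tree X in constr:(MRunV t)
  | _ =>
      lazymatch type of f with
      | Vector.sort (@Hom _ _ ?A ?B) =>
          let s := reify_tree A in let t := reify_tree B in
          constr:(@MGen _ _ s t f)
      end
  end.

(** [tail_simpl] associates composites to the right, so an equation has to be usable in front of a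
    further factor [u]. *)
Lemma comp_cong (k : fieldType) (C : lincat k) (X Y Z : C) (g : Hom Y Z)
    (f : Hom X Y) (h : Hom X Z) : g \co f = h ->
  forall W (u : Hom W X), g \co (f \co u) = h \co u.
Proof. by move=> <- W u; rewrite compA. Qed.

Lemma comp_cong4 (k : fieldType) (C : lincat k) (X Y Y' Z : C) (g : Hom Y Z)
    (f : Hom X Y) (g' : Hom Y' Z) (f' : Hom X Y') : g \co f = g' \co f' ->
  forall W (u : Hom W X), g \co (f \co u) = g' \co (f' \co u).
Proof. by move=> e W u; rewrite !compA e. Qed.

Lemma whl_cong (k : fieldType) (C : moncat k) (V X Y Z : C) (g : Hom Y Z)
    (f : Hom X Y) (h : Hom X Z) : g \co f = h ->
  whl V g \co whl V f = whl V h.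
Proof. by move=> <-; rewrite whl_comp. Qed.

Lemma whl_cong4 (k : fieldType) (C : moncat k) (V X Y Y' Z : C) (g : Hom Y Z)
    (f : Hom X Y) (g' : Hom Y' Z) (f' : Hom X Y') : g \co f = g' \co f' ->
  whl V g \co whl V f = whl V g' \co whl V f'.
Proof. by move=> e; rewrite -!whl_comp e. Qed.

Ltac tail_simpl :=
  cbn [mtail whisk nf]; rewrite ?whl_comp ?tensm1 ?comp1m ?compm1 -?compA.

Ltac tail_simpl_in H :=
  cbn [mtail whisk nf] in H;
  rewrite ?whl_comp ?tensm1 ?comp1m ?compm1 -?compA in H.

Ltac strict :=
  lazymatch goal with
  | |- ?f = ?g =>
      let m := reify_mor f in let n := reify_mor g in
      apply: (@mtail_inj _ _ _ _ m n); tail_simpl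
  end.

(* [tail_of H W E]: the strict form at the tail [W] of the equation [H]. *)
Ltac tail_of H W E :=
  lazymatch type of H with
  | ?f = ?g =>
      let m := reify_mor f in let n := reify_mor g in
      have E := @mtail_eq _ _ _ _ m n W H; tail_simpl_in E
  end.

(* [tail_nat f g E]: the interchange of [f] with [g] acting on its tail. *)
Ltac tail_nat f g E :=
  let m := reify_mor f in
  lazymatch m with @MGen _ _ ?s ?t _ =>
    have E := @gen_natural _ _ s t f _ _ g; tail_simpl_in E
  end.

(** * The adjunction map of a pairing *)

Section Phi.
Variables (k : fieldType) (C : moncat k).
Implicit Types X Y Z W D : C.

(** For a left dual [D] of [X] this is the adjunction bijection from Hom(Z, W (x) D) to Hom(Z (x) X,
    W); here [ev] may be any pairing. *)
Definition Phi D X (ev : Hom (D \ot X) munit) Z W (c : Hom Z (W \ot D)) :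
  Hom (Z \ot X) W := run W \co whl W ev \co ass W D X \co (c \otm idm X).

Variables (X D : C) (ev : Hom (D \ot X) munit).

Lemma Phi_comp Z Z' W (c : Hom Z (W \ot D)) (z : Hom Z' Z) :
  Phi ev (c \co z) = Phi ev c \co (z \otm idm X).
Proof. by rewrite /Phi -[RHS]compA -tensm_comp comp1m. Qed.

Lemma Phi_target Z W W' (w : Hom W W') (c : Hom Z (W \ot D)) :
  Phi ev ((w \otm idm D) \co c) = w \co Phi ev c.
Proof.
rewrite /Phi; strict.
tail_nat w (gen (s := Node (Leaf D) (Leaf X)) (t := Unit) ev munit) E.
by rewrite (comp_cong4 E).
Qed.

Lemma PhiB Z W (c c' : Hom Z (W \ot D)) :
  Phi ev (c - c') = Phi ev c - Phi ev c'.
Proof. by rewrite /Phi tensBl compBr. Qed.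

Lemma Phi0 Z W : Phi ev (0 : Hom Z (W \ot D)) = 0.
Proof. by rewrite /Phi tens0m compm0. Qed.

Lemma Phi_source Y DY (evY : Hom (DY \ot Y) munit) (f : Hom X Y) (f' : Hom DY D)
    Z W (c : Hom Z (W \ot DY)) :
  ev \co (f' \otm idm X) = evY \co whl DY f ->
  Phi ev (whl W f' \co c) = Phi evY c \co whl Z f.
Proof.
move=> e; rewrite /Phi; strict.
tail_of e (munit : C) E.
tail_nat c (gen (s := Leaf X) (t := Leaf Y) f munit) E'.
by rewrite E' (comp_cong4 (whl_cong4 W E)).
Qed.

Variable coev : Hom munit (X \ot D).
Hypothesis zz1 : run X \co (idm X \otm ev) \co ass X D X \co
  (coev \otm idm X) \co lunV X = idm X.
Hypothesis zz2 : lun D \co (ev \otm idm D) \co assV D X D \co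
  (idm D \otm coev) \co runV D = idm D.

(** Bending [X] back with [coev] undoes [Phi], by the second zigzag identity. *)
Lemma Phi_inj Z W : injective (@Phi _ _ ev Z W).
Proof.
suff K (c : Hom Z (W \ot D)) :
    (Phi ev c \otm idm D) \co assV Z X D \co whl Z coev \co runV Z = c.
  by move=> c c' e; rewrite -[c]K e K.
rewrite /Phi; strict.
tail_of zz2 (munit : C) E.
tail_nat c (gen (s := Unit) (t := Node (Leaf X) (Leaf D)) coev munit) E'.
by rewrite E' (comp_cong (whl_cong W E)) tensm1 comp1m.
Qed.

Lemma Phi_surj Z W (h : Hom (Z \ot X) W) : exists c, Phi ev c = h.
Proof.
exists ((h \otm idm D) \co assV Z X D \co whl Z coev \co runV Z).
rewrite /Phi; strict.
tail_of zz1 (munit : C) E.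
tail_nat h (gen (s := Node (Leaf D) (Leaf X)) (t := Unit) ev munit) E'.
by rewrite (comp_cong4 (esym E')) (whl_cong Z E) tensm1 compm1.
Qed.

End Phi.

(** * Kernels, cokernels and simple objects *)

Section AbelianFacts.
Variables (k : fieldType) (C : lincat k).
Implicit Types X Y Z A B : C.

Lemma monoP X Y (f : Hom X Y) :
  mono f <-> forall Z (u : Hom Z X), f \co u = 0 -> u = 0.
Proof.
split=> [fm Z u e|fm Z u v e]; first by apply: fm; rewrite e compm0.
by apply/eqP; rewrite -subr_eq0; apply/eqP/fm; rewrite compBr e subrr.
Qed.

Lemma epiP X Y (f : Hom X Y) :
  epi f <-> forall Z (u : Hom Y Z), u \co f = 0 -> u = 0.
Proof.
split=> [fm Z u e|fm Z u v e]; first by apply: fm; rewrite e comp0m.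
by apply/eqP; rewrite -subr_eq0; apply/eqP/fm; rewrite compBl e subrr.
Qed.

Lemma kernel_mono K X Y (f : Hom X Y) (i : Hom K X) : is_kernel f i -> mono i.
Proof.
case=> fi univ Z u v e; have [|h [_ uniq]] := univ Z (i \co u).
  by rewrite compA fi comp0m.
by rewrite -(uniq u) // -(uniq v).
Qed.

Lemma kernel_lift K X Y (f : Hom X Y) (i : Hom K X) : is_kernel f i ->
  forall Z (g : Hom Z X), f \co g = 0 -> exists h, i \co h = g.
Proof. by case=> _ univ Z g /univ [h [e _]]; exists h. Qed.

Lemma cokernel_epi X Y Q (f : Hom X Y) (p : Hom Y Q) : is_cokernel f p -> epi p.
Proof.
case=> fi univ Z u v e; have [|h [_ uniq]] := univ Z (u \co p).
  by rewrite -compA fi compm0.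
by rewrite -(uniq u) // -(uniq v).
Qed.

Lemma cokernel_lift X Y Q (f : Hom X Y) (p : Hom Y Q) : is_cokernel f p ->
  forall Z (g : Hom Y Z), g \co f = 0 -> exists h, h \co p = g.
Proof. by case=> _ univ Z g /univ [h [e _]]; exists h. Qed.

Lemma kernelI K X Y (f : Hom X Y) (i : Hom K X) : f \co i = 0 -> mono i ->
  (forall Z (g : Hom Z X), f \co g = 0 -> exists h, i \co h = g) ->
  is_kernel f i.
Proof.
move=> fi im lift; split=> // Z g /lift [h hE]; exists h; split=> // h'.
by rewrite -hE => /im.
Qed.

Lemma cokernelI X Y Q (f : Hom X Y) (p : Hom Y Q) : p \co f = 0 -> epi p ->
  (forall Z (g : Hom Y Z), g \co f = 0 -> exists h, h \co p = g) ->
  is_cokernel f p.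
Proof.
move=> fi im lift; split=> // Z g /lift [h hE]; exists h; split=> // h'.
by rewrite -hE => /im.
Qed.

Hypothesis abC : abelian C.

(** An epimorphism is the cokernel of some [g], which factors through the kernel [a]; so whatever
    kills [a] kills [g]. *)
Lemma epi_cokernel A X B (a : Hom A X) (e : Hom X B) :
  epi e -> is_kernel e a -> is_cokernel a e.
Proof.
move=> ee ka; apply: cokernelI => //; first by case: ka.
have [Z [g kg]] := ab_epi abC ee.
have [eg0 _] := kg; have [h hE] := kernel_lift ka eg0.
move=> U u ua; apply: cokernel_lift kg _ _ _.
by rewrite -hE compA ua comp0m.
Qed.

Lemma mono_kernel A X B (a : Hom A X) (e : Hom X B) :
  mono a -> is_cokernel a e -> is_kernel e a.
Proof.
move=> ee ka; apply: kernelI => //; first by case: ka.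
have [Z [g kg]] := ab_mono abC ee.
have [eg0 _] := kg; have [h hE] := cokernel_lift ka eg0.
move=> U u ua; apply: kernel_lift kg _ _ _.
by rewrite -hE -compA ua compm0.
Qed.

Lemma pullback_epi (P Q R : C) (e : Hom P Q) (c : Hom R Q) : epi e ->
  exists G (g : Hom G P) (f : Hom G R), e \co g = c \co f /\ epi f.
Proof.
move=> ee; have [S [i1 [i2 [p1 [p2 [p11 p22 p12 p21 ip]]]]]] :=
  ab_biproduct abC P R.
(* The pullback is the kernel of [d], which is epic since its restriction to [P] is [e]. *)
pose d := e \co p1 - c \co p2.
have di1 : d \co i1 = e.
  by rewrite compBl -!compA p11 p21 compm0 compm1 subr0.
have ed : epi d.
  apply/epiP=> Z u ud; apply: (proj1 (epiP e) ee).
  by rewrite -di1 compA ud comp0m.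
have [G [n kn]] := ab_kernel abC d.
exists G, (p1 \co n), (p2 \co n); split.
  apply/eqP; rewrite -subr_eq0 !compA -compBl; apply/eqP.
  by case: kn.
apply/epiP=> Z u; rewrite compA => up.
(* A map [u] killing the projection to [R] satisfies [u p2 = v d]; restricting to [P] gives
   [v e = 0], so [v] and then [u] vanish. *)
have [v vd] := cokernel_lift (epi_cokernel ed kn) up.
have v0 : v = 0.
  by apply: (proj1 (epiP e) ee); rewrite -di1 compA vd -compA p21 compm0.
by rewrite -[u]compm1 -p22 compA -vd v0 !comp0m.
Qed.

Lemma is_iso_epi X Y (f : Hom X Y) : is_iso f -> epi f.
Proof.
by case=> g [gf fg] Z u v e; rewrite -[u]compm1 -[v]compm1 -fg !compA e.
Qed.

Lemma is_iso_mono X Y (f : Hom X Y) : is_iso f -> mono f.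
Proof.
by case=> g [gf fg] Z u v e; rewrite -[u]comp1m -[v]comp1m -gf -!compA e.
Qed.

Lemma is_zero_id X : is_zero X <-> idm X = 0.
Proof.
split=> [[z _]|e]; first exact: z.
by split=> Y f; [rewrite -[f]compm1 e compm0 | rewrite -[f]comp1m e comp0m].
Qed.

Lemma schur X (z : Hom X X) : simple X -> z <> 0 -> is_iso z.
Proof.
move=> [Xnz Xs] znz; have [K [i ki]] := ab_kernel abC z.
have [K0|[j [_ ij]]] := Xs _ _ (kernel_mono ki); last first.
  by case: znz; rewrite -[z]compm1 -ij compA; case: ki => -> _; rewrite comp0m.
have zm : mono z.
  apply/monoP=> Z u /(kernel_lift ki) [h <-].
  by case: K0 => _ /(_ _ h) ->; rewrite compm0.
by case: (Xs _ _ zm).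
Qed.

End AbelianFacts.

(** * Equivalences of categories *)

Section Equivalence.
Variables (k : fieldType) (C D : lincat k) (F : functor C D).
Hypothesis eqF : equivalence F.

Lemma equivalence_faithful X Y (f g : Hom X Y) : fmor F f = fmor F g -> f = g.
Proof.
have [G [eta [eps [ie _ en _]]]] := eqF => e.
by apply: (is_iso_mono (ie Y)); rewrite !en e.
Qed.

Lemma equivalence_full X Y (g : Hom (F X) (F Y)) : exists f, fmor F f = g.
Proof.
have [G [eta [eps [ie ip en pn]]]] := eqF.
have [y [yK Ky]] := ie Y.
exists (y \co fmor G g \co eta X).
have faithG X' Y' (u v : Hom X' Y') : fmor G u = fmor G v -> u = v.
  by move=> e; apply: (is_iso_epi (ip X')); rewrite !pn e.
apply: faithG; apply: (is_iso_epi (ie X)).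
by rewrite -en !compA Ky comp1m.
Qed.

Lemma equivalence_surj Y : exists X (f : Hom (F X) Y), is_iso f.
Proof. by have [G [eta [eps [_ ip _ _]]]] := eqF; exists (G Y), (eps Y). Qed.

(** Up to isomorphism the test object lies in the image of [F], and its maps then lift along [F] by
    fullness. *)
Lemma equivalence_mono X Y (i : Hom X Y) : mono i -> mono (fmor F i).
Proof.
move=> im Z u v e; have [Z' [j [j' [jj' j'j]]]] := equivalence_surj Z.
have [a aE] := equivalence_full (u \co j).
have [b bE] := equivalence_full (v \co j).
have ab : a = b.
  apply: im; apply: equivalence_faithful.
  by rewrite !fmor_comp aE bE !compA e.
by rewrite -[u]compm1 -[v]compm1 -j'j !compA -aE -bE ab.
Qed.

End Equivalence.

(** * Duality and exactness *)

(** Yoneda form of an r-category: the universal pairing [dev X] replaces the natural bijections, and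
    the equivalence enters through [dmor_epi] and [dobj_surj]. *)
Record duality_data (k : fieldType) (C : moncat k) := DualityData {
  dobj : C -> C;
  dmor : forall X Y : C, Hom X Y -> Hom (dobj Y) (dobj X);
  dev : forall X : C, Hom (dobj X \ot X) munit;
  dev_inj : forall X Z,
    injective (fun g : Hom Z (dobj X) => dev X \co (g \otm idm X));
  dev_surj : forall X Z (t : Hom (Z \ot X) munit),
    exists g : Hom Z (dobj X), dev X \co (g \otm idm X) = t;
  dev_dmor : forall X Y (f : Hom X Y),
    dev X \co (dmor f \otm idm X) = dev Y \co whl (dobj Y) f;
  dmor_epi : forall X Y (f : Hom X Y), mono f -> epi (dmor f);
  dobj_surj : forall W, exists W' (j : Hom W (dobj W')), is_iso j
}.
Arguments dev {k C} d X.
Arguments dobj {k C} d X.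
Arguments dmor {k C} d {X Y} f.
Arguments dev_inj {k C} d {X Z} [x1 x2].
Arguments dev_surj {k C} d {X Z} t.
Arguments dev_dmor {k C} d {X Y} f.
Arguments dmor_epi {k C} d {X Y f} _.

Lemma r_category_duality (k : fieldType) (C : moncat k) :
  r_category C -> inhabited (duality_data C).
Proof.
case=> D [phi [rep nat_phi]] eqD; constructor.
pose ev X : Hom ((D X : C) \ot X) munit := phi X (D X) (idm (D X : C)).
have phiE X Z (g : Hom Z (D X : C)) : phi X Z g = ev X \co (g \otm idm X).
  by have [_ /(_ _ _ g (idm _))] := rep X; rewrite comp1m.
apply: (@DualityData _ _ (fun X => D X : C) (fun X Y f => fmor D f) ev).
- move=> X Z g g' /=; rewrite -!phiE.
  by have [/(_ Z) /bij_inj inj _] := rep X; exact: inj.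
- move=> X Z t; have [/(_ Z) [g gK Kg] _] := rep X.
  by exists (g t); rewrite -phiE Kg.
- move=> X Y f; have := nat_phi X Y (D Y : C) f (idm _).
  by rewrite compm1 phiE.
- by move=> X Y f /(equivalence_mono eqD).
- move=> W; have [X [f [g [gf fg]]]] := equivalence_surj eqD (W : opcat C).
  by exists X, f, g.
Qed.

Section Exactness.
Variables (k : fieldType) (C : moncat k) (dd : duality_data C).
Implicit Types X Y Z W A B : C.
Notation D := (dobj dd).
Notation ev := (dev dd).

(* The adjunction of [- (x) X] and [D (X (x) D^-1 -)] is stated as a relation
   because representability only provides propositional inverses. *)
Lemma tens_adjoint X W :
  exists R (adj : forall Z, Hom (Z \ot X) W -> Hom Z R -> Prop),
  [/\ forall Z h, exists y, adj Z h y, forall Z y, exists h, adj Z h y,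
      forall Z h h' y, adj Z h y -> adj Z h' y -> h = h',
      forall Z h y y', adj Z h y -> adj Z h y' -> y = y'
    & forall Z Z' (z : Hom Z' Z) h y,
        adj Z h y -> adj Z' (h \co (z \otm idm X)) (y \co z)].
Proof.
have [W' [j [j' [j'j jj']]]] := dobj_surj dd W.
(* With [W] written as [D W'], both sides become pairings of [Z] with [X (x) W']. *)
exists (D (X \ot W')), (fun Z h y => ev W' \co ((j \co h) \otm idm W') \co
  assV Z X W' = ev (X \ot W') \co (y \otm idm _)).
split=> [Z h|Z y|Z h h' y e e'|Z h y y' e e'|Z Z' z h y e].
- have [y yE] := dev_surj dd
    (ev W' \co ((j \co h) \otm idm W') \co assV Z X W').
  by exists y; rewrite yE.
- have [h hE] := dev_surj dd (ev (X \ot W') \co (y \otm idm _) \co ass Z X W').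
  exists (j' \co h); rewrite (compA j) jj' comp1m hE.
  by rewrite -compA assVK compm1.
- have : j \co h = j \co h'.
    apply: (dev_inj dd) => /=; apply: (split_epi (assK Z X W')).
    by rewrite e -e'.
  by move=> /(congr1 (compm j')); rewrite !compA j'j !comp1m.
- by apply: (dev_inj dd); rewrite /= -e -e'.
have -> : (j \co (h \co (z \otm idm X))) \otm idm W' =
    ((j \co h) \otm idm W') \co ((z \otm idm X) \otm idm W').
  by rewrite -tensm_comp comp1m compA.
rewrite -!compA -assV_natural !compA e tensm1 -!compA -tensm_comp.
by rewrite comp1m.
Qed.

Lemma epi_tensl X Y Z (p : Hom Y Z) : epi p -> epi (p \otm idm X).
Proof.
move=> ep; apply/epiP=> W u e.
have [R [adj [tot _ injl injr nat]]] := tens_adjoint X W.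
have [y hy] := tot _ u; have [z hz] := tot _ (0 : Hom (Z \ot X) W).
suff yz : y = z by apply: (injl _ _ _ _ hy); rewrite yz.
apply: ep; apply: (injr _ _ _ _ (nat _ _ p _ _ hy)).
by have := nat _ _ p _ _ hz; rewrite comp0m e.
Qed.

Lemma cokernel_tensl X A B Y (i : Hom A Y) (p : Hom Y B) : is_cokernel i p ->
  is_cokernel (i \otm idm X) (p \otm idm X).
Proof.
move=> cp; have pe := cokernel_epi cp; apply: cokernelI.
- by rewrite -tensm_comp; case: cp => -> _; rewrite tens0m.
- exact: epi_tensl.
move=> W u e; have [R [adj [tot surj injl injr nat]]] := tens_adjoint X W.
have [y hy] := tot _ u; have [z hz] := tot _ (0 : Hom (A \ot X) W).
have yi : y \co i = 0.
  have zE : z = 0.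
    have := nat _ _ (0 : Hom A A) _ _ hz; rewrite comp0m compm0.
    exact: injr _ _ _ _ hz.
  by rewrite -zE; apply: (injr _ _ _ _ (nat _ _ i _ _ hy)); rewrite e.
have [y' y'E] := cokernel_lift cp yi; have [h hh] := surj _ y'.
by exists h; apply: (injl _ _ _ _ (nat _ _ p _ _ hh)); rewrite y'E.
Qed.

Variable bc : braiding C.

Lemma epi_tensr X Y Z (p : Hom Y Z) : epi p -> epi (whl X p).
Proof.
move=> ep W u v e.
apply: (is_iso_epi (br_iso bc Z X)); apply: (epi_tensl (X := X) ep).
by rewrite -!compA br_natural !compA e.
Qed.

Lemma cokernel_tensr X A B Y (i : Hom A Y) (p : Hom Y B) : is_cokernel i p ->
  is_cokernel (whl X i) (whl X p).
Proof.
move=> cp; have pe := cokernel_epi cp; apply: cokernelI.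
- by rewrite -tensm_comp; case: cp => -> _; rewrite tensm0.
- exact: epi_tensr.
move=> W u e; have [|h hE] := cokernel_lift (cokernel_tensl X cp)
  (g := u \co br bc Y X).
  by rewrite -compA br_natural compA e comp0m.
have [b [bK Kb]] := br_iso bc B X.
exists (h \co b); apply: (is_iso_epi (br_iso bc Y X)).
by rewrite -hE -compA -br_natural compA -(compA h) bK compm1.
Qed.

End Exactness.

(** * Braids *)

Section Braids.
Variables (k : fieldType) (C : moncat k) (bc : braiding C).
Implicit Types X Y Z W : C.

Definition sw X Y W : Hom (X \ot (Y \ot W)) (Y \ot (X \ot W)) :=
  gen (s := Node (Leaf X) (Leaf Y)) (t := Node (Leaf Y) (Leaf X)) (br bc X Y) W.

Definition cap Y X (p : Hom (Y \ot X) munit) W : Hom (Y \ot (X \ot W)) W :=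
  gen (s := Node (Leaf Y) (Leaf X)) (t := Unit) p W.

Definition cup Y X (i : Hom munit (Y \ot X)) W : Hom W (Y \ot (X \ot W)) :=
  gen (s := Unit) (t := Node (Leaf Y) (Leaf X)) i W.

Lemma gen_iso s t (f : Hom (otree s) (otree t)) : is_iso f ->
  forall W, is_iso (gen f W).
Proof.
move=> [g [gf fg]] W; exists (gen g W).
have mE (u v w : tree C) (a : Hom (otree u) (otree v))
    (b : Hom (otree v) (otree w)) :
  gen b W \co gen a W = gen (b \co a) W.
  exact: (@mtail_eq _ _ _ _ (MComp (MGen b) (MGen a)) (MGen (b \co a))).
have iE (u : tree C) : gen (idm (otree u)) W = idm (nf u W).
  exact: (@mtail_eq _ _ _ _ (MGen (idm (otree u))) (MId u)).
by rewrite !mE gf fg !iE.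
Qed.

Lemma sw_natural X Y W W' (f : Hom W W') :
  sw X Y W' \co whl X (whl Y f) = whl Y (whl X f) \co sw X Y W.
Proof.
exact: (gen_natural (s := Node (Leaf X) (Leaf Y))
                    (t := Node (Leaf Y) (Leaf X))).
Qed.

Lemma cap_natural Y X (p : Hom (Y \ot X) munit) W W' (f : Hom W W') :
  cap p W' \co whl Y (whl X f) = f \co cap p W.
Proof. exact: (gen_natural (s := Node (Leaf Y) (Leaf X)) (t := Unit)). Qed.

Lemma cup_natural Y X (i : Hom munit (Y \ot X)) W W' (f : Hom W W') :
  cup i W' \co f = whl Y (whl X f) \co cup i W.
Proof. exact: (gen_natural (s := Unit) (t := Node (Leaf Y) (Leaf X))). Qed.

Lemma sw_hex X Y Z W :
  gen (s := Node (Leaf X) (Node (Leaf Y) (Leaf Z)))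
      (t := Node (Node (Leaf Y) (Leaf Z)) (Leaf X)) (br bc X (Y \ot Z)) W =
  whl Y (sw X Z W) \co sw X Y (Z \ot W).
Proof. by tail_of (hexagon bc X Y Z) W E. Qed.

Lemma sw_hexV X Y Z W :
  gen (s := Node (Node (Leaf X) (Leaf Y)) (Leaf Z))
      (t := Node (Leaf Z) (Node (Leaf X) (Leaf Y))) (br bc (X \ot Y) Z) W =
  sw X Z (Y \ot W) \co whl X (sw Y Z W).
Proof. by tail_of (hexagonV bc X Y Z) W E. Qed.

Lemma iso_idem (A : C) (b : Hom A A) : is_iso b -> b \co b = b -> b = idm A.
Proof. by move=> /is_iso_mono im bb; apply: im; rewrite compm1. Qed.

(* The hexagon at [X, 1, 1] makes the braiding with the unit idempotent. *)
Lemma sw_unit X W : gen (s := Node (Leaf X) Unit) (t := Node Unit (Leaf X))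
  (br bc X munit) W = idm (X \ot W).
Proof.
apply: iso_idem.
  exact: (gen_iso (s := Node (Leaf X) Unit) (t := Node Unit (Leaf X))
    (br_iso bc X munit)).
tail_of (hexagon bc X munit munit) W E; rewrite -E.
by tail_of (br_natural bc (idm X) (lun munit)) W E'.
Qed.

Lemma sw_unitV X W : gen (s := Node Unit (Leaf X)) (t := Node (Leaf X) Unit)
  (br bc munit X) W = idm (X \ot W).
Proof.
apply: iso_idem.
  exact: (gen_iso (s := Node Unit (Leaf X)) (t := Node (Leaf X) Unit)
    (br_iso bc munit X)).
tail_of (hexagonV bc munit munit X) W E; rewrite -E.
by tail_of (br_natural bc (lun munit) (idm X)) W E'.
Qed.

(** A strand slides past the cap: naturality of the braiding in [p], the crossing with the unit
    being trivial. *)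
Lemma sw_cap Z Y X (p : Hom (Y \ot X) munit) W :
  cap p (Z \ot W) \co (whl Y (sw Z X W) \co sw Z Y (X \ot W)) = whl Z (cap p W).
Proof.
tail_of (br_natural bc (idm Z) p) W E.
by move: E; rewrite sw_unit sw_hex comp1m.
Qed.

Lemma sw_capV Z Y X (p : Hom (Y \ot X) munit) W :
  whl Z (cap p W) \co (sw Y Z (X \ot W) \co whl Y (sw X Z W)) = cap p (Z \ot W).
Proof.
tail_of (br_natural bc p (idm Z)) W E.
by move: E; rewrite sw_unitV sw_hexV comp1m.
Qed.

Lemma sw_cup Z Y X (i : Hom munit (Y \ot X)) W :
  whl Y (sw Z X W) \co (sw Z Y (X \ot W) \co whl Z (cup i W)) = cup i (Z \ot W).
Proof.
tail_of (br_natural bc (idm Z) i) W E.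
by move: E; rewrite sw_unit sw_hex compm1 -compA.
Qed.

(** Naturality of the crossing with [X] along [br bc Y Z], expanded by the hexagon. *)
Lemma yang_baxter X Y Z W :
  sw Y Z (X \ot W) \co (whl Y (sw X Z W) \co sw X Y (Z \ot W)) =
  whl Z (sw X Y W) \co (sw X Z (Y \ot W) \co whl X (sw Y Z W)).
Proof.
tail_of (br_natural bc (idm X) (br bc Y Z)) W E.
by move: E; rewrite !sw_hex -!compA.
Qed.

End Braids.

(** * Dualizable objects and short exact sequences *)

Section Dualizable.
Variables (k : fieldType) (C : moncat k) (dd : duality_data C).
Variables (bc : braiding C) (abC : abelian C).
Implicit Types X Y Z W A B E L M : C.
Notation D := (dobj dd).
Notation ev := (dev dd).

Definition dualizable X : Prop :=
  exists c : Hom munit (X \ot D X), Phi (ev X) c = lun X.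

(** Endomorphisms of [D X] are separated by pairing with [X], so the zigzag on [D X] follows from
    the one on [X]. *)
Lemma dualizable_zz X : dualizable X ->
  exists c : Hom munit (X \ot D X),
    run X \co whl X (ev X) \co ass X (D X) X \co (c \otm idm X) \co lunV X
      = idm X /\
    lun (D X) \co (ev X \otm idm (D X)) \co assV (D X) X (D X)
      \co whl (D X) c \co runV (D X) = idm (D X).
Proof.
case=> c cE; exists c.
have zz1 : run X \co whl X (ev X) \co ass X (D X) X \co (c \otm idm X)
    \co lunV X = idm X.
  by move: cE; rewrite /Phi => ->; rewrite lunVK.
split=> //; apply: (dev_inj dd) => /=; strict.
tail_of zz1 (munit : C) E1.
tail_nat (ev X) (cap (ev X) munit) E2; rewrite /cap in E2.
by rewrite -(comp_cong4 E2) (whl_cong _ E1) tensm1 compm1.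
Qed.

Lemma dualizable_left_dual X : dualizable X -> is_left_dual X (D X).
Proof. by move=> /dualizable_zz [c [z1 z2]]; exists (ev X), c. Qed.

Lemma dualizable_Phi_inj X Z W : dualizable X ->
  injective (@Phi _ _ (D X) X (ev X) Z W).
Proof. by move=> /dualizable_zz [c [z1 z2]]; exact: (Phi_inj z2). Qed.

Lemma dualizable_Phi_surj X Z W (h : Hom (Z \ot X) W) : dualizable X ->
  exists c, Phi (ev X) c = h.
Proof. by move=> /dualizable_zz [c [z1 z2]]; exact: (Phi_surj z1). Qed.

(** By universality [e] is [ev X] precomposed with some [y : Y -> D X]; this [y] carries [c] to
    [X (x) D X], and the inverse of the zigzag normalizes the result. *)
Lemma dualizable_of_zigzag X Y (e : Hom (Y \ot X) munit)
    (c : Hom munit (X \ot Y)) : is_iso (Phi e c) -> dualizable X.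
Proof.
move=> [z [zP Pz]]; have [y yE] := dev_surj dd e.
exists (((lun X \co z) \otm idm (D X)) \co (whl X y \co c)).
have -> := Phi_target (ev X) (lun X \co z) (whl X y \co c).
rewrite (Phi_source (evY := e) (f := idm X)) ?tensm1 ?compm1 //.
by rewrite -compA zP compm1.
Qed.

Lemma left_dual_dualizable X Y : is_left_dual X Y -> dualizable X.
Proof.
case=> e [c [z1 _]]; apply: (@dualizable_of_zigzag X Y e c).
exists (lunV X); have PE : Phi e c = lun X; last by rewrite PE lunK lunVK.
apply: (split_epi (lunK X)).
by rewrite lunVK -z1.
Qed.

Lemma dualizable_zero X : is_zero X -> dualizable X.
Proof.
case=> _ z; exists 0; rewrite Phi0; symmetry; exact: z.
Qed.

Lemma dualizable_unit : dualizable munit.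
Proof.
apply: (@left_dual_dualizable munit munit).
exists (lun munit), (lunV munit); split; strict; done.
Qed.

Lemma dualizable_tens X Y :
  dualizable X -> dualizable Y -> dualizable (X \ot Y).
Proof.
move=> /dualizable_zz [c [z1 _]] /dualizable_zz [d [t1 _]].
apply: (@dualizable_of_zigzag (X \ot Y) (D Y \ot D X)
  (ev Y \co whl (D Y) (lun Y \co (ev X \otm idm Y) \co assV (D X) X Y)
     \co ass (D Y) (D X) (X \ot Y))
  (assV X Y (D Y \ot D X) \co whl X (ass Y (D Y) (D X) \co
     (d \otm idm (D X)) \co lunV (D X)) \co c)).
exists (lunV _); set P := Phi _ _.
have PE : P = lun _; last by rewrite PE lunK lunVK.
rewrite /P /Phi; strict.
tail_of z1 (Y \ot munit) E1; tail_of t1 (munit : C) E2.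
tail_nat d (cap (ev X) (Y \ot munit)) E3; rewrite /cap in E3.
rewrite -(comp_cong4 (whl_cong4 X E3)) (comp_cong (whl_cong X E2)) tensm1.
by rewrite comp1m E1.
Qed.

(** Maps [Z -> D X] are pairings [Z (x) X -> 1], and [Z (x) -] preserves cokernels. *)
Lemma dual_kernel A X B (i : Hom A X) (p : Hom X B) : is_cokernel i p ->
  is_kernel (dmor dd i) (dmor dd p).
Proof.
move=> cp; have [pi0 _] := cp.
have nat1 Y Y' Z (f : Hom Y Y') (v : Hom Z (D Y')) :
    ev Y \co ((dmor dd f \co v) \otm idm Y) =
    ev Y' \co (v \otm idm Y') \co whl Z f.
  rewrite -[idm Y]comp1m tensm_comp compA dev_dmor -!compA -!tensm_comp.
  by rewrite !comp1m !compm1.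
apply: kernelI.
- apply: (dev_inj dd) => /=; rewrite nat1 dev_dmor tens0m compm0.
  by rewrite -compA -whl_comp pi0 tensm0 compm0.
- move=> Z u v e; apply: (dev_inj dd) => /=.
  apply: (epi_tensr (X := Z) dd bc (cokernel_epi cp)).
  by rewrite -!nat1 e.
move=> Z v e; have [|t tE] := cokernel_lift (cokernel_tensr dd bc Z cp)
  (g := ev X \co (v \otm idm X)).
  by rewrite -nat1 e tens0m compm0.
have [w wE] := dev_surj dd t; exists w; apply: (dev_inj dd) => /=.
by rewrite nat1 wE tE.
Qed.

(* Tensoring with [X] keeps [a] monic although it is only right exact: the
   epimorphism [f : G -> 1] lifts the coevaluation of [B] to [E], so that
   [E (x) f] and [E (x) G -> B (x) L (x) E -> E] agree after [e], and their
   difference [E (x) G -> A] extends [A (x) f]. *)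
Lemma tens_mono A E B L (a : Hom A E) (e : Hom E B) (evL : Hom (B \ot L) munit)
    (coevL : Hom munit (L \ot B)) X :
  is_kernel e a -> epi e ->
  lun B \co (evL \otm idm B) \co assV B L B \co whl B coevL \co runV B
    = idm B ->
  mono (whl X a).
Proof.
move=> ka ee zz; have [ea0 _] := ka.
have [G [phi [f [phiE fe]]]] :=
  pullback_epi abC coevL (epi_tensr dd bc (X := L) ee).
pose d2 := lun E \co (evL \otm idm E) \co assV B L E \co (e \otm phi).
have d2E : e \co d2 = e \co (run E \co whl E f).
  rewrite /d2; strict.
  tail_nat evL (gen (s := Leaf E) (t := Leaf B) e munit) E1.
  tail_nat e (whl L (gen (s := Leaf E) (t := Leaf B) e munit)) E2.
  tail_of phiE (munit : C) E3.
  tail_nat e (cup coevL munit) E4; rewrite /cup in E4.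
  tail_of zz (munit : C) E5.
  rewrite -(comp_cong4 E1) -(comp_cong4 E2) (whl_cong4 _ E3).
  by rewrite (comp_cong4 E4) (comp_cong E5) comp1m.
have [|d dE] := kernel_lift ka (g := run E \co whl E f - d2).
  by rewrite compBr d2E subrr.
have dA : d \co (a \otm idm G) = run A \co whl A f.
  apply: (kernel_mono ka).
  rewrite compA dE compBl -[d2 \co _]compA -[_ \co (a \otm _)]compA.
  rewrite -!tensm_comp ea0 tens0m !compm0 subr0 comp1m compm1.
  by rewrite compA -run_natural -compA -tensm_comp comp1m compm1.
apply/monoP=> K u ua.
(* Through [d], the composite of [u] with [K (x) f] factors through [(X (x) a) u = 0]. *)
have fK : u \co (run K \co whl K f) = 0.
  transitivity (whl X d \co ass X E G \co ((whl X a \co u) \otm idm G)).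
    have -> : u \co (run K \co whl K f) =
       whl X (run A \co whl A f) \co ass X A G \co (u \otm idm G).
      strict; tail_nat u (gen (s := Leaf G) (t := Unit) f munit) E1.
      by rewrite E1.
    have -> : (whl X a \co u) \otm idm G =
        (whl X a \otm idm G) \co (u \otm idm G) by rewrite -tensm_comp comp1m.
    by rewrite -dA whl_comp -!compA (comp_cong4 (ass_natural _ _ _)).
  by rewrite ua tens0m compm0.
apply: (split_epi (runVK K)); apply: (epi_tensr (X := K) dd bc fe).
by rewrite comp0m -compA fK comp0m.
Qed.

Lemma tens_kernel A E B L (a : Hom A E) (e : Hom E B)
    (evL : Hom (B \ot L) munit) (coevL : Hom munit (L \ot B)) X :
  is_kernel e a -> epi e ->
  lun B \co (evL \otm idm B) \co assV B L B \co whl B coevL \co runV B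
    = idm B ->
  is_kernel (whl X e) (whl X a).
Proof.
move=> ka ee zz; apply: (mono_kernel abC (tens_mono (X := X) ka ee zz)).
exact: (cokernel_tensr dd bc X (epi_cokernel abC ee ka)).
Qed.

(** The dualized sequence ends in [D A], for which [A] serves as the dual required by
    [tens_kernel]. *)
Lemma tens_dual_kernel A X B (i : Hom A X) (p : Hom X B) W :
  dualizable A -> short_exact i p ->
  is_kernel (whl W (dmor dd i)) (whl W (dmor dd p)).
Proof.
move=> /dualizable_zz [c [_ z2]] [ki cp].
apply: (tens_kernel W (dual_kernel cp) _ z2).
exact: (dmor_epi dd (kernel_mono ki)).
Qed.

Lemma Phi_dmor X Y (f : Hom X Y) Z W (c : Hom Z (W \ot D Y)) :
  Phi (ev X) (whl W (dmor dd f) \co c) = Phi (ev Y) c \co whl Z f.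
Proof. exact: Phi_source (dev_dmor dd f). Qed.

(** The coevaluation of [M], pushed to [X (x) D M], dies in [X (x) D L] because [q j = 0]; so it
    comes from the kernel [X (x) D X]. *)
Lemma dualizable_cokernel L M X (j : Hom L M) (q : Hom M X) :
  short_exact j q -> dualizable L -> dualizable M -> dualizable X.
Proof.
move=> se dL dM; have [kj cq] := se; have [c cE] := dM.
have [|d dE] := kernel_lift (tens_dual_kernel X dL se)
  (g := (q \otm idm (D M)) \co c).
  apply: (dualizable_Phi_inj dL); rewrite Phi0 Phi_dmor Phi_target cE.
  by rewrite -compA lun_natural compA; case: cq => -> _; rewrite comp0m.
exists d; apply: (epi_tensr (X := munit) dd bc (cokernel_epi cq)).
by rewrite -Phi_dmor dE Phi_target cE lun_natural.
Qed.

(* On the pullback [f : G -> 1] of [X (x) D X -> X (x) D A] along the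
   coevaluation of [A], [Phi g] and [f (x) X] agree on [A], hence differ by a
   map through [B]; correcting [g] by the dual of that map makes it factor
   through [f], and the factor is the coevaluation of [X]. *)
Lemma dualizable_extension A X B (i : Hom A X) (p : Hom X B) :
  short_exact i p -> dualizable A -> dualizable B -> dualizable X.
Proof.
move=> se dA dB; have [ki cp] := se; have [cA cAE] := dA.
(* Dévissage: a [v] killed by [Phi] vanishes in [W (x) D A], so it comes from [W (x) D B], where
   [Phi] is injective. *)
have PhiX_inj Z W (v : Hom Z (W \ot D X)) : Phi (ev X) v = 0 -> v = 0.
  move=> v0; have [|w wE] := kernel_lift (tens_dual_kernel W dA se) (g := v).
    by apply: (dualizable_Phi_inj dA); rewrite Phi0 Phi_dmor v0 comp0m.
  rewrite -wE; suff -> : w = 0 by rewrite compm0.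
  apply: (dualizable_Phi_inj dB); rewrite Phi0.
  apply: (epi_tensr (X := Z) dd bc (cokernel_epi cp)).
  by rewrite -Phi_dmor wE v0 comp0m.
have [G [g [f [gE fe]]]] := pullback_epi abC ((i \otm idm (D A)) \co cA)
  (epi_tensr dd bc (X := X) (dmor_epi dd (kernel_mono ki))).
have [|h' h'E] := cokernel_lift (cokernel_tensr dd bc G cp)
  (g := Phi (ev X) g - lun X \co (f \otm idm X)).
  rewrite compBl -Phi_dmor gE -compA Phi_target Phi_comp cAE.
  have fi : (f \otm idm X) \co whl G i = whl munit i \co (f \otm idm A).
    by rewrite -!tensm_comp !comp1m !compm1.
  by rewrite -(compA (lun X)) fi !compA lun_natural subrr.
have [h hE] := dualizable_Phi_surj h' dB.
pose g' := g - whl X (dmor dd p) \co h.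
have g'E : Phi (ev X) g' = lun X \co (f \otm idm X).
  by rewrite PhiB Phi_dmor hE h'E subKr.
have [K [n kn]] := ab_kernel abC f.
have [|c cE] := cokernel_lift (epi_cokernel abC fe kn) (g := g').
  apply: PhiX_inj; rewrite Phi_comp g'E -compA -tensm_comp.
  by case: kn => -> _; rewrite tens0m compm0.
exists c; apply: (epi_tensl dd (X := X) fe).
by rewrite -Phi_comp cE g'E.
Qed.

(** Braiding lets [D X] serve as a dual on the other side: the inverse crossing put into the
    coevaluation cancels after a Yang-Baxter move. *)
Lemma braided_zigzag X : dualizable X ->
  exists (e : Hom (X \ot D X) munit) (c : Hom munit (D X \ot X)),
  lun X \co (e \otm idm X) \co assV X (D X) X \co whl X c \co runV X
    = idm X.
Proof.
move=> /dualizable_zz [c [z1 _]]; have [b [bK Kb]] := br_iso bc (D X) X.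
exists (ev X \co br bc X (D X)), (b \co c); strict.
tail_of z1 (munit : C) E1; tail_of Kb (munit : C) E2.
change (cap (ev X) (X \ot munit) \co (sw bc X (D X) (X \ot munit) \co
  (whl X (gen (s := Node (Leaf X) (Leaf (D X)))
              (t := Node (Leaf (D X)) (Leaf X)) b munit) \co
   whl X (cup c munit))) = idm (X \ot munit)).
rewrite -(sw_capV bc X) -!compA (compA (whl (D X) _)).
rewrite (compA (sw bc (D X) X _)) yang_baxter -!compA.
rewrite (comp_cong (whl_cong X E2)) tensm1 comp1m.
by rewrite sw_cup; exact: E1.
Qed.

(** The braiding moves [Z] to the left, where [tens_kernel] applies with the dual of [B] from
    [braided_zigzag]. *)
Lemma tensl_lift A E B (a : Hom A E) (e : Hom E B) Z :
  dualizable B -> is_kernel e a -> epi e ->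
  forall Z' (v : Hom Z' (E \ot Z)), (e \otm idm Z) \co v = 0 ->
  exists w, (a \otm idm Z) \co w = v.
Proof.
move=> dB ka ee Z' v ev0; have [eB [cB zB]] := braided_zigzag dB.
have [|w wE] := kernel_lift (tens_kernel Z ka ee zB) (g := br bc E Z \co v).
  by rewrite compA -br_natural -compA ev0 compm0.
have [b [bK Kb]] := br_iso bc A Z.
exists (b \co w); apply: (is_iso_mono (br_iso bc E Z)).
by rewrite compA br_natural -compA (compA _ b) Kb comp1m.
Qed.

(** The coevaluation of [E], pushed to [E (x) D A], dies in [B (x) D A]: there it is the
    coevaluation of [B] followed by the dual of [e a = 0]. Its lift to [A (x) D A] is the
    coevaluation of [A]. *)
Lemma dualizable_kernel A E B (a : Hom A E) (e : Hom E B) :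
  short_exact a e -> dualizable E -> dualizable B -> dualizable A.
Proof.
move=> [ka ce] dE dB; have [cE cEE] := dE; have [cB cBE] := dB.
have eB : (e \otm idm (D E)) \co cE = whl B (dmor dd e) \co cB.
  apply: (dualizable_Phi_inj dE).
  by rewrite Phi_dmor Phi_target cEE cBE lun_natural.
have e0 : (e \otm idm (D A)) \co (whl E (dmor dd a) \co cE) = 0.
  rewrite compA -tensm_comp comp1m compm1.
  rewrite -[dmor dd a]compm1 -[e]comp1m tensm_comp -compA eB compA.
  by rewrite -tensm_comp; have [-> _] := dual_kernel ce; rewrite tensm0 comp0m.
have [d dE'] := tensl_lift dB ka (cokernel_epi ce) e0.
exists d; apply: (kernel_mono ka).
by rewrite -Phi_target dE' Phi_dmor cEE lun_natural.
Qed.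

End Dualizable.

(** * Partial trace *)

Lemma linear_inj_dim (k : fieldType) (U V : vectType k) (f : U -> V) :
  linear f -> injective f -> (\dim {: U} <= \dim {: V})%N.
Proof.
move=> lf injf.
pose fL := GRing.isLinear.Build k U V *:%R f lf.
pose fl : {linear U -> V} := HB.pack f fL.
have k0 : (fullv :&: lker (linfun fl))%VS = 0%VS.
  by apply/eqP; rewrite capfv; apply/lker0P=> x y; rewrite !lfunE; exact: injf.
by rewrite -(limg_dim_eq k0) dimvS ?subvf.
Qed.

Section PartialTrace.
Variables (k : fieldType) (C : moncat k) (bc : braiding C).
Variables (X Y : C) (p : Hom (Y \ot X) munit) (i : Hom munit (Y \ot X)).
Hypothesis pi1 : p \co i = idm munit.
Implicit Types V W : C.

(** The partial trace over the first strand, with [Y] in the role of a dual of [X]. *)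
Definition ptr W V (f : Hom (X \ot W) (X \ot V)) : Hom W V :=
  cap p V \co (whl Y f \co cup i W).

Lemma cap_cup W : cap p W \co cup i W = idm W.
Proof. by tail_of pi1 W E. Qed.

Lemma ptr_compl W V V' (g : Hom V V') (f : Hom (X \ot W) (X \ot V)) :
  ptr (whl X g \co f) = g \co ptr f.
Proof. by rewrite /ptr whl_comp -!compA (comp_cong4 (cap_natural _ _)). Qed.

Lemma ptr_whl W V (g : Hom W V) : ptr (whl X g) = g.
Proof.
by rewrite /ptr (comp_cong4 (cap_natural _ _)) cap_cup compm1.
Qed.

Lemma ptr1 W : ptr (idm (X \ot W)) = idm W.
Proof. by rewrite -tensm1 ptr_whl. Qed.

Lemma ptr_compr W W' V (g : Hom W' W) (f : Hom (X \ot W) (X \ot V)) :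
  ptr (f \co whl X g) = ptr f \co g.
Proof. by rewrite /ptr whl_comp -!compA -cup_natural. Qed.

Lemma ptr_linear W V : linear (@ptr W V).
Proof.
move=> a f g; rewrite /ptr whlD whlZ.
by rewrite compDl compDr compZl compZr.
Qed.

(** The closed strand slides across the other one at both [cup] and [cap], and the crossing cancels
    its inverse. *)
Lemma ptr_conj W V (f : Hom (X \ot W) (X \ot V))
    (s' : Hom (X \ot (X \ot W)) (X \ot (X \ot W))) :
  s' \co sw bc X X W = idm _ ->
  ptr (sw bc X X V \co (whl X f \co s')) = whl X (ptr f).
Proof.
move=> s's; rewrite /ptr -(sw_cup bc X i) !whl_comp -!compA.
rewrite (comp_cong (whl_cong Y s's)) tensm1 comp1m.
rewrite -(comp_cong4 (sw_natural bc X Y f)).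
by rewrite (compA (whl Y _) (sw _ _ _ _)) (compA (cap _ _)) sw_cap.
Qed.

Lemma gen0 s t W : gen (0 : Hom (otree s) (otree t)) W = 0.
Proof. by rewrite genE tens0m compm0 comp0m. Qed.

Lemma Phi0_tail (c : Hom munit (X \ot Y)) W : Phi p c = 0 ->
  whl X (cap p W) \co cup c (X \ot W) = 0.
Proof.
have tailE (h : Hom (munit \ot X) X) : Phi p c = h ->
    whl X (cap p W) \co cup c (X \ot W) =
    gen (s := Node Unit (Leaf X)) (t := Leaf X) h W.
  by rewrite /Phi => e; tail_of e W E.
by move=> /tailE ->; rewrite gen0.
Qed.

Lemma cup_comp Z Z' (g : Hom (Y \ot X) (Z \ot Z')) W :
  cup (g \co i) W = gen (s := Node (Leaf Y) (Leaf X))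
    (t := Node (Leaf Z) (Leaf Z')) g W \co cup i W.
Proof.
exact: (@mtail_eq _ _ _ _
  (MGen (s := Unit) (t := Node (Leaf Z) (Leaf Z')) (g \co i))
  (MComp (MGen (s := Node (Leaf Y) (Leaf X)) (t := Node (Leaf Z) (Leaf Z')) g)
         (MGen (s := Unit) (t := Node (Leaf Y) (Leaf X)) i))).
Qed.

Lemma sw_invr b W : br bc X Y \co b = idm _ ->
  sw bc X Y W \co gen (s := Node (Leaf Y) (Leaf X))
                      (t := Node (Leaf X) (Leaf Y)) b W = idm _.
Proof. by move=> e; tail_of e W E. Qed.

(** Sliding past the cap turns the curl into the zigzag of [p] with the braided [i], which is
    assumed zero. *)
Lemma ptr_sw b W : br bc X Y \co b = idm _ -> Phi p (b \co i) = 0 ->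
  ptr (sw bc X X W) = 0.
Proof.
move=> Kb /(Phi0_tail W) <-; rewrite cup_comp.
by rewrite /ptr -(sw_cap bc X p) -!compA (comp_cong (sw_invr _ Kb)) comp1m.
Qed.

Lemma ptr_swV W (s' : Hom (X \ot (X \ot W)) (X \ot (X \ot W))) :
  sw bc X X W \co s' = idm _ ->
  Phi p (br bc Y X \co i) = 0 -> ptr s' = 0.
Proof.
move=> ss' /(Phi0_tail W); rewrite cup_comp => E.
rewrite /ptr -(sw_capV bc X p) -!compA (comp_cong (whl_cong Y ss')).
by rewrite tensm1 comp1m; exact: E.
Qed.

Variable b : Hom (X \ot X) (X \ot X).
Hypotheses (bK : b \co br bc X X = idm _) (Kb : br bc X X \co b = idm _).

Definition swV W : Hom (X \ot (X \ot W)) (X \ot (X \ot W)) :=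
  gen (s := Node (Leaf X) (Leaf X)) (t := Node (Leaf X) (Leaf X)) b W.

Lemma swK W : swV W \co sw bc X X W = idm _.
Proof. by tail_of bK W E. Qed.

Lemma swVK W : sw bc X X W \co swV W = idm _.
Proof. by tail_of Kb W E. Qed.

(* Lifts to braids of the coset representatives of [S_n] in [S_(n+1)]. *)
Fixpoint cyc n j : Hom (tens_pow X n.+1) (tens_pow X n.+1) :=
  match n, j with
  | n'.+1, j'.+1 => sw bc X X (tens_pow X n') \co whl X (cyc n' j')
  | _, _ => idm _
  end.

(** The inverse braids. The default value at [n = 0] and positive [j] is excluded below by
    [j <= n]. *)
Fixpoint cycV n j : Hom (tens_pow X n.+1) (tens_pow X n.+1) :=
  match n, j with
  | n'.+1, j'.+1 => whl X (cycV n' j') \co swV (tens_pow X n')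
  | _, _ => idm _
  end.

Hypotheses (ptr_sw0 : forall W, ptr (sw bc X X W) = 0)
           (ptr_swV0 : forall W, ptr (swV W) = 0).

(** If both indices are positive, [ptr_conj] strips a crossing from each side; if exactly one is
    zero, a single crossing is left under the trace, which kills it. *)
Lemma ptr_cyc n j m : (j <= n)%N -> (m <= n)%N ->
  ptr (cyc n j \co cycV n m) = if j == m then idm _ else 0.
Proof.
elim: n j m => [|n IHn] [|j] [|m] //= jn mn.
- by rewrite comp1m; exact: ptr1.
- by rewrite comp1m; exact: ptr1.
- by rewrite comp1m ptr_compl ptr_swV0 compm0.
- by rewrite compm1 ptr_compr ptr_sw0 comp0m.
rewrite -compA (compA (whl X _)) -whl_comp ptr_conj ?swK // IHn // eqSS.
by case: eqP; rewrite ?tensm1 ?tensm0.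
Qed.

Lemma dim_tens_pow_step n :
  (n.+1 * \dim {: Hom (tens_pow X n) (tens_pow X n)} <=
   \dim {: Hom (tens_pow X n.+1) (tens_pow X n.+1)})%N.
Proof.
pose U := {ffun 'I_n.+1 -> Hom (tens_pow X n) (tens_pow X n)}.
pose F (g : U) : Hom (tens_pow X n.+1) (tens_pow X n.+1) :=
  \sum_(j < n.+1) whl X (g j) \co cyc n j.
have linF : linear F.
  move=> a f g; rewrite /F scaler_sumr -big_split; apply: eq_bigr => j _ /=.
  by rewrite !ffunE whlD whlZ compDl compZl.
have ptrF (g : U) (m : 'I_n.+1) : ptr (F g \co cycV n m) = g m.
  pose psi (h : Hom (tens_pow X n.+1) (tens_pow X n.+1)) :
    Hom (tens_pow X n) (tens_pow X n) := ptr (h \co cycV n m).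
  have psi0 : psi 0 = 0 by rewrite /psi comp0m (linear_zero (@ptr_linear _ _)).
  have psiD h h' : psi (h + h') = psi h + psi h'.
    by rewrite /psi compDl (linear_add (@ptr_linear _ _)).
  rewrite -/(psi _) (big_morph psi psiD psi0) (bigD1 m) //= big1 => [|j jm].
    by rewrite addr0 /psi -compA ptr_compl ptr_cyc ?eqxx ?compm1 ?leq_ord.
  rewrite /psi -compA ptr_compl ptr_cyc ?leq_ord //.
  by rewrite -val_eqE in jm; rewrite (negbTE jm) compm0.
have injF : injective F.
  by move=> f g e; apply/ffunP=> m; rewrite -!ptrF e.
have dimU : dim U = (n.+1 * dim (Hom (tens_pow X n) (tens_pow X n)))%N.
  by rewrite -[in RHS](card_ord n.+1).
by rewrite !dimvf -dimU -!dimvf; exact: linear_inj_dim linF injF.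
Qed.

Lemma fact_le_dim_tens_pow n : idm (munit : C) <> 0 ->
  (n`! <= \dim {: Hom (tens_pow X n) (tens_pow X n)})%N.
Proof.
move=> /eqP id0; elim: n => [|n IHn]; last first.
  exact: leq_trans (leq_mul (leqnn _) IHn) (dim_tens_pow_step n).
(* For [n = 0] the power is [munit], whose nonzero identity spans a line of endomorphisms. *)
by apply: leq_trans (dimvS (subvf <[idm (munit : C)]>)); rewrite dim_vline id0.
Qed.

End PartialTrace.

(** * Rigidity *)

Section Rigidity.
Variables (k : fieldType) (C : moncat k) (dd : duality_data C).
Variables (bc : braiding C) (abC : abelian C).
Implicit Types X Y Z T : C.

Lemma simple_dualizable X Y (p : Hom (Y \ot X) munit)
    (i : Hom munit (Y \ot X)) :
  simple X -> p \co i = idm munit -> idm (munit : C) <> 0 ->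
  moderate_growth X -> dualizable dd X.
Proof.
move=> sX pi1 id0 [n]; have [b [bK Kb]] := br_iso bc X X.
have [b' [b'K Kb']] := br_iso bc X Y.
have zigzag (c : Hom munit (X \ot Y)) : Phi p c = 0 \/ dualizable dd X.
  have [->|/eqP nz] := eqVneq (Phi p c) 0; [by left | right].
  apply: (@dualizable_of_zigzag _ _ dd X Y p c).
  have [|g [gz zg]] := schur abC (z := Phi p c \co lunV X) sX.
    by move=> e; apply: nz; rewrite -[LHS]compm1 -(lunK X) compA e comp0m.
  exists (lunV X \co g); split; last by rewrite compA.
  rewrite -[Phi p c]compm1 -(lunK X) (compA (Phi p c)) -compA (compA g) gz.
  by rewrite comp1m.
(* The two signs of the crossing: [b'] is the inverse of [br bc X Y], and the next line uses
   [br bc Y X] itself. *)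
have [zig|//] := zigzag (b' \co i).
have [zigV|//] := zigzag (br bc Y X \co i).
have := @fact_le_dim_tens_pow _ _ bc X Y p i pi1 b bK
  (fun W => ptr_sw W Kb' zig) (fun W => ptr_swV (swVK Kb W) zigV) n id0.
by rewrite leqNgt => /negbTE ->.
Qed.

Lemma left_dual_iso X Y Y' (j : Hom Y' Y) : is_iso j -> is_left_dual X Y ->
  is_left_dual X Y'.
Proof.
move=> [j' [j'j jj']] [e [c [z1 z2]]].
exists (e \co (j \otm idm X)), (whl X j' \co c); split; strict.
  tail_of z1 (munit : C) E1; tail_of jj' (X \ot munit) E2.
  by rewrite (comp_cong (whl_cong X E2)) tensm1 comp1m E1.
tail_of z2 (munit : C) E1; tail_of j'j (munit : C) E2.
tail_nat j (whl X (gen (s := Leaf Y) (t := Leaf Y') j' munit)) E3.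
tail_nat j (cup c munit) E4; rewrite /cup in E4.
tail_nat e (gen (s := Leaf Y) (t := Leaf Y') j' munit) E5.
by rewrite (comp_cong4 E3) E4 (comp_cong4 E5) (comp_cong E1) comp1m E2.
Qed.

Lemma comp_series_dualizable X s : comp_series X s ->
  (forall T, List.In T s -> dualizable dd T) -> dualizable dd X.
Proof.
elim=> {X s} [X zX _|A X T s i p se sT _ IHA dT]; first exact: dualizable_zero.
apply: (dualizable_extension bc abC se); last by apply: dT; left.
by apply: IHA => T' T's; apply: dT; right.
Qed.

(** The factors above [T] are removed from the top as dualizable quotients; then [T] is a quotient
    by a subobject with factors [s2]. *)
Lemma comp_series_factor_dualizable X s1 T s2 :
  comp_series X (s1 ++ T :: s2) -> dualizable dd X ->
  (forall T', List.In T' (s1 ++ s2) -> dualizable dd T') -> dualizable dd T.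
Proof.
elim: s1 X => [|T1 s1 IHs1] X /= cs dX ds.
  move eqs : (T :: s2) cs => s cs.
  case: cs eqs dX => // A X' T' s' i p se _ cA [-> eqs] dX.
  apply: (dualizable_cokernel bc abC se _ dX).
  by apply: (comp_series_dualizable cA); rewrite -eqs.
move eqs : (T1 :: _) cs => s cs.
case: cs eqs dX => // A X' T' s' i p se _ cA [eT eqs] dX.
subst T' s'; apply: IHs1 cA _ _.
  by apply: (dualizable_kernel bc abC se dX); apply: ds; left.
by move=> T2 T2s; apply: ds; right.
Qed.

Lemma tens_seq_dualizable (Xs : seq C) :
  (forall Y, List.In Y Xs -> dualizable dd Y) -> dualizable dd (tens_seq Xs).
Proof.
elim: Xs => [|Y Xs IHXs] dXs; first exact: dualizable_unit.
apply: dualizable_tens; first by apply: dXs; left.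
by apply: IHXs => Z ZXs; apply: dXs; right.
Qed.

Lemma filtration_dualizable (S : C -> Prop) (Irr : nat -> C -> Prop) :
  (forall X, finite_length X) -> recursive_filtration S Irr ->
  (forall X, S X -> dualizable dd X) -> forall X, dualizable dd X.
Proof.
move=> fl [_ _ exh rec] dS.
have dIrr n : forall X, Irr n X -> dualizable dd X.
  (* One script serves both cases: at level 0 the predicate on the other factors is [False], so
     there are none. *)
  elim: n => [|n IHn] X /rec [Xs [XsS [s1 [s2 [cs low]]]]];
    apply: (comp_series_factor_dualizable cs) => [|T /low //]; try exact: IHn;
    apply: tens_seq_dualizable => Y YXs; have [s csY] := fl Y;
    apply: (comp_series_dualizable csY) => T Ts;
    by apply/dS/(XsS _ YXs); exists s.
move=> X; have [s cs] := fl X; apply: (comp_series_dualizable cs) => T Ts.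
suff /exh [n /dIrr] : simple T by [].
by elim: cs Ts => // A X' T' s' i p _ sT' _ IHs' [<-|/IHs'].
Qed.

End Rigidity.

Theorem theorem4p11 (k : closedFieldType) (C : moncat k) (br : braiding C)
    (S : C -> Prop) (Irr : nat -> C -> Prop)
    (C_semirigid : semirigid C)
    (C_moderate : moderate_growth_cat C)
    (S_irr : irr_subset S)
    (S_non_negligible : forall X : C, S X -> non_negligible X)
    (Irr_filtration : recursive_filtration S Irr) :
  forall X : C, rigid X.
Proof.
have [abC rC fl s1] := C_semirigid; have [dd] := r_category_duality rC.
have dual : forall X, dualizable dd X.
  apply: (filtration_dualizable br abC fl Irr_filtration) => X SX.
  have [indX [Y [B [i [_ [p [_ [pi1 _ _ _ _]]]]]]]] := S_non_negligible X SX.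
  apply: (simple_dualizable dd br abC (proj1 S_irr X SX) pi1).
    by move=> /is_zero_id; case: s1.
  exact: C_moderate.
move=> X; split.
  by exists (dobj dd X); apply: dualizable_left_dual.
(* [X] is isomorphic to some [D Y], a left dual of [Y], so [Y] is a right dual of [X]. *)
have [Y [j ij]] := dobj_surj dd X.
by exists Y; apply: (left_dual_iso ij); apply: dualizable_left_dual.
Qed.
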